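(* Let $G$ be a $d$-dimensional simplicial complex with Laplacian matrix $L_G=\partial_d^{G}\cdot(\partial_d^{G})^T$. Then, $x$ being an indeterminate, $$\sum_{(F,R)} |H_{d-1}(F,R)|^2\, x^{|R|}= \det(L_G+x\cdot \mathrm{Id}),$$ where the sum is over all rooted forests $(F,R)$ of $G$ and $\mathrm{Id}$ is the identity matrix of dimension $|G_{d-1}|$. More generally, let $\{x_r\}_{r\in G_{d-1}}$ and $\{y_f\}_{f\in G_{d}}$ be indeterminates indexed by the $(d-1)$-faces and the $d$-faces of $G$ respectively. Let $X$ (resp. $Y$) be the diagonal matrix with rows and columns indexed by $G_{d-1}$ (resp. $G_d$) whose diagonal entry in the row indexed by $r$ is $x_r$ (resp. in the row indexed by $f$ is $y_f$), and let $L_G^y=\partial_d^{G}\cdot Y\cdot (\partial_d^{G})^T$. Then $$\sum_{(F,R)} |H_{d-1}(F,R)|^2 \prod_{r\in R}x_r\prod_{f\in F}y_f= \det(L_G^y+X),$$ where the sum is over all rooted forests $(F,R)$ of $G$.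
   Context: A simplicial complex on $n$ vertices is a nonempty collection $G$ of subsets of $[n]=\{1,\dots,n\}$ closed under taking subsets; its elements are called faces. A $k$-face is a face of cardinality $k+1$ (so $\emptyset$ is the $(-1)$-face), $G_k$ is the set of $k$-faces, and the dimension $d\ge 0$ of $G$ is the maximal dimension of its faces. Incidence matrix: for $k\ge 0$, $\partial_k^{G}$ is the matrix with rows indexed by $G_{k-1}$ and columns indexed by $G_k$ whose entry $\partial_k^{G}[r,f]$ is $(-1)^j$ if $f=\{v_0,\dots,v_k\}$ with $v_0<\cdots<v_k$ and $r=f\setminus\{v_j\}$, and $0$ if $r\not\subset f$. It is also viewed as the boundary map sending combinations of $k$-faces to combinations of $(k-1)$-faces. A subset $F\subseteq G_d$ is a forest of $G$ if the columns of $\partial_d^{G}$ indexed by $F$ are linearly independent (over $\mathbb{R}$). For $R\subseteq G_{d-1}$ write $\overline{R}=G_{d-1}\setminus R$. For a forest $F$, let $\partial_d^{F}$ be the submatrix of $\partial_d^{G}$ with columns indexed by $F$ and all rows indexed by $G_{d-1}$; $R$ is a root of $F$ if the rows of $\partial_d^{F}$ indexed by $\overline{R}$ form a basis of the row space of $\partial_d^{F}$. A rooted forest of $G$ is a pair $(F,R)$ where $F\subseteq G_d$ is a forest of $G$ (possibly empty) and $R\subseteq G_{d-1}$ is a root of $F$. Relative homology: for $F\subseteq G_d$ and $R\subseteq G_{d-1}$, let $\Psi_{F,R}:\mathbb{Z}F\to \mathbb{Z}G_{d-1}/\mathbb{Z}R$ be the group homomorphism $x\mapsto \partial_d^{G}(x)+\mathbb{Z}R$,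 where $\mathbb{Z}S$ denotes the free abelian group on a set $S$. Then $H_{d-1}(F,R)=\operatorname{coker}\Psi_{F,R}=(\mathbb{Z}G_{d-1}/\mathbb{Z}R)/\operatorname{Im}(\Psi_{F,R})$, and $|H_{d-1}(F,R)|$ is its cardinality. *)

(* Defs.v *)
From HB Require Import structures.
From mathcomp Require Import all_boot all_order all_algebra finmap.
From mathcomp Require classical_sets cardinality.
From mathcomp Require Import boolp reals.
From mathcomp Require Import mpoly.

Set Implicit Arguments.
Unset Strict Implicit.
Unset Printing Implicit Defensive.

Import GRing.Theory Quotient.
Local Open Scope ring_scope.
Local Open Scope quotient_scope.

(* The vertex set {1, ..., n} is rendered, with its order, as 'I_n. *)
Definition simplicial_complex (n : nat) (G : {set {set 'I_n}}) : Prop :=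
  G != set0 /\ forall f g : {set 'I_n}, f \in G -> g \subset f -> g \in G.

Definition complex_dim (n : nat) (G : {set {set 'I_n}}) : int :=
  (\max_(f in G) #|f|)%N%:Z - 1.

(* [k] ranges over the integers, so that the (-1)-face is available. *)
Definition face (n : nat) (G : {set {set 'I_n}}) (k : int) : finType :=
  {f : {set 'I_n} | (f \in G) && (#|f|%:Z == k + 1)}.

(* [enum f] lists the vertices of [f] in increasing order, so that
   [index v (enum f)] is the j such that v = v_j. *)
Definition incidence (A : pzRingType) (n : nat) (r f : {set 'I_n}) : A :=
  if [pick v in f | r == f :\ v] is Some v then (-1) ^+ index v (enum f) else 0.

Definition boundary (A : pzRingType) (n : nat) (G : {set {set 'I_n}}) (k : nat) :
    'M[A]_(#|face G (k%:Z - 1)|, #|face G k|) :=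
  \matrix_(i, j) incidence A (val (enum_val i)) (val (enum_val j)).

Section RootedForest.
Variables (K : realType) (n : nat) (G : {set {set 'I_n}}) (d : nat).
Implicit Types (F : {set face G d}) (R : {set face G (d%:Z - 1)}).

Definition forest F : bool :=
  free [seq col (enum_rank f) (boundary K G d) | f in F].

Definition forest_boundary F : 'M[K]_(#|face G (d%:Z - 1)|, #|F|) :=
  colsub (fun j : 'I_#|F| => enum_rank (enum_val j)) (boundary K G d).

Definition forest_row F (r : face G (d%:Z - 1)) : 'rV[K]_#|F| :=
  row (enum_rank r) (forest_boundary F).

Definition root_of F R : bool :=
  basis_of <<[seq forest_row F r | r : face G (d%:Z - 1)]>>%VS
           [seq forest_row F r | r in ~: R].

Definition rooted_forest F R : bool := forest F && root_of F R.

End RootedForest.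

Section RelativeHomology.
Variables (n : nat) (G : {set {set 'I_n}}).

Definition chain (k : int) : zmodType := 'cV[int]_#|face G k|.

(* The free abelian group on S, as a subgroup of the one on all k-faces. *)
Definition chain_on (k : int) (S : {set face G k}) : {pred chain k} :=
  [pred x : chain k | [forall f, (f \notin S) ==> (x (enum_rank f) 0 == 0)]].

Lemma chain_on_zmod_closed k (S : {set face G k}) : zmod_closed (chain_on S).
Proof.
split=> [|x y /forallP xS /forallP yS]; apply/forallP=> f; apply/implyP=> fS.
  by rewrite mxE.
by rewrite !mxE (eqP (implyP (xS f) fS)) (eqP (implyP (yS f) fS)) subrr.
Qed.

HB.instance Definition _ k (S : {set face G k}) :=
  GRing.isZmodClosed.Build (chain k) (chain_on S) (chain_on_zmod_closed S).

Variable d : nat.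
Implicit Types (F : {set face G d}) (R : {set face G (d%:Z - 1)}).

Definition relative_chain R : zmodType := {quot chain_on R}.

Definition Psi R (x : chain d) : relative_chain R :=
  \pi_({quot chain_on R}) (boundary int G d *m x).
Arguments Psi : clear implicits.

Lemma PsiB R : {morph Psi R : x y / x - y}.
Proof.
by move=> x y; rewrite /Psi mulmxBr [LHS]raddfB.
Qed.

Definition Psi_image F R : {pred relative_chain R} :=
  [pred q | `[< exists2 x, x \in chain_on F & Psi R x = q >]].
Arguments Psi_image : clear implicits.

Lemma Psi_image_zmod_closed F R : zmod_closed (Psi_image F R).
Proof.
split=> [|_ _ /asboolP[x xF <-] /asboolP[y yF <-]]; apply/asboolP.
  by exists 0; [exact: rpred0 | rewrite -(subrr 0) PsiB subrr].
by exists (x - y); [exact: rpredB | exact: PsiB].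
Qed.

HB.instance Definition _ F R :=
  GRing.isZmodClosed.Build (relative_chain R) (Psi_image F R)
    (Psi_image_zmod_closed F R).

Definition relative_homology F R : zmodType := {quot Psi_image F R}.

(* [fset_set] is empty on infinite sets: the value is 0 if the group is infinite,
   which does not happen when (F, R) is a rooted forest. *)
Definition homology_card F R : nat :=
  #|` cardinality.fset_set (@classical_sets.setT (relative_homology F R)) |%fset.

End RelativeHomology.
Arguments Psi {n G d} R x.
Arguments Psi_image {n G d} F R.

Definition laplacian (A : pzRingType) (n : nat) (G : {set {set 'I_n}}) (d : nat) :
    'M[A]_#|face G (d%:Z - 1)| :=
  boundary A G d *m (boundary A G d)^T.

Definition weighted_laplacian (A : pzRingType) (n : nat) (G : {set {set 'I_n}})
    (d : nat) (y : face G d -> A) : 'M[A]_#|face G (d%:Z - 1)| :=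
  boundary A G d *m diag_mx (\row_j y (enum_val j)) *m (boundary A G d)^T.

(* The indeterminates x_r and y_f live in one polynomial ring, the x_r first. *)
Definition xvar (n : nat) (G : {set {set 'I_n}}) (d : nat)
    (r : face G (d%:Z - 1)) : {mpoly int[#|face G (d%:Z - 1)| + #|face G d|]} :=
  'X_(lshift _ (enum_rank r)).

Definition yvar (n : nat) (G : {set {set 'I_n}}) (d : nat)
    (f : face G d) : {mpoly int[#|face G (d%:Z - 1)| + #|face G d|]} :=
  'X_(rshift _ (enum_rank f)).

(* Main.v *)
(* With M the boundary matrix, M Y M^T + X = [M | Id] diag(y, x) [M | Id]^T, so
   Cauchy-Binet writes its determinant as a sum of squared maximal minors of
   [M | Id], indexed by the column sets F + R.  Such a minor is nonzero exactly
   when (F, R) is a rooted forest, and its columns span the subgroup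
   Z^R + d(Z^F) of the chain group, whose index |H(F, R)| is then the absolute
   value of the minor (Smith normal form). *)
Require Import Defs.
From mathcomp Require Import all_boot all_order all_algebra perm.
From mathcomp Require classical_sets cardinality.
From mathcomp Require Import finmap boolp.
From mathcomp Require Import reals mpoly.
Set Implicit Arguments.
Unset Strict Implicit.
Unset Printing Implicit Defensive.
Local Open Scope ring_scope.

Import GRing.Theory Num.Theory Quotient.
Local Open Scope quotient_scope.

(** * Cauchy-Binet for a weighted Gram matrix *)

(** Distributing each Leibniz product over the entry sums gives a sum over functions [f] from rows
    to [J]; for fixed [f], the sum over permutations is again a determinant. If [f] is not
    injective, two of its rows coincide and it vanishes. *)
Lemma det_gram_expand (A : comPzRingType) m (J : finType)
    (B : 'I_m -> J -> A) (w : J -> A) :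
  \det (\matrix_(i, j) \sum_s B i s * w s * B j s)
  = \sum_(f : {ffun 'I_m -> J} | injectiveb f)
      (\prod_i B i (f i)) * (\prod_i w (f i)) * \det (\matrix_(i, j) B j (f i)).
Proof.
pose BB (s : 'S_m) i x := B i x * w x * B (s i) x.
transitivity (\sum_(f : {ffun 'I_m -> J}) \sum_(s : 'S_m)
    (-1) ^+ s * \prod_i BB s i (f i)).
  rewrite exchange_big; apply: eq_bigr => /= s _; rewrite -big_distrr /=.
  congr (_ * _); rewrite -(bigA_distr_bigA (BB s)) /=.
  by apply: eq_bigr => i _; rewrite mxE.
have fE (f : {ffun 'I_m -> J}) : \sum_(s : 'S_m) (-1) ^+ s * \prod_i BB s i (f i)
    = (\prod_i B i (f i)) * (\prod_i w (f i)) * \det (\matrix_(i, j) B j (f i)).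
  rewrite big_distrr /=; apply: eq_bigr => s _.
  rewrite mulrCA !big_split /=; congr (_ * (_ * _)).
  by apply: eq_bigr => i _; rewrite mxE.
rewrite (eq_bigr _ (fun f _ => fE f)).
rewrite [LHS](bigID (fun f : {ffun 'I_m -> J} => injectiveb f)) /=.
rewrite [X in _ + X]big1 ?addr0 // => f Uf.
case/injectivePn: Uf => i1 [i2 Di12 Ef12].
by rewrite (determinant_alternate Di12) ?mulr0 //= => j; rewrite !mxE Ef12.
Qed.

(** Reordering the columns changes a maximal minor only by a sign, so its square can be given as a
    function [D] of the column set. *)
Lemma cauchy_binet_gram (A : comPzRingType) m (J : finType)
    (B : 'I_m -> J -> A) (w : J -> A) (D : {set J} -> A) :
    (forall f : {ffun 'I_m -> J}, injective f ->
       D (f @: setT) = \det (\matrix_(i, j) B i (f j)) ^+ 2) ->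
  \det (\matrix_(i, j) \sum_s B i s * w s * B j s)
  = \sum_(S : {set J} | #|S| == m) D S * \prod_(s in S) w s.
Proof.
move=> DE; rewrite det_gram_expand.
pose im (f : {ffun 'I_m -> J}) := f @: [set: 'I_m].
rewrite (partition_big im (fun S => #|S| == m)) /=; last first.
  by move=> f /injectiveP f_inj; rewrite card_imset // cardsT card_ord.
apply: eq_bigr => S /eqP cardS.
have [f0 f0_inj imf0] : exists2 f0 : {ffun 'I_m -> J}, injective f0 & im f0 = S.
  pose g i : J := enum_val (cast_ord (esym cardS) i).
  have g_inj : injective g by move=> i j /enum_val_inj /cast_ord_inj.
  exists (finfun g) => [i j|]; first by rewrite !ffunE => /g_inj.
  apply/eqP; rewrite eqEcard card_imset ?cardsT ?card_ord ?cardS ?leqnn ?andbT //.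
    by apply/subsetP=> _ /imsetP[i _ ->]; rewrite ffunE enum_valP.
  by move=> i j; rewrite !ffunE => /g_inj.
pose h (s : 'S_m) : {ffun 'I_m -> J} := [ffun i => f0 (s i)].
have h_inj : injective h.
  by move=> s t /ffunP st; apply/permP=> i; apply: f0_inj; move: (st i); rewrite !ffunE.
(* Once an enumeration [f0] of [S] is fixed, the injective functions with image [S] are exactly the
   composites of [f0] with a permutation. *)
have imh (f : {ffun 'I_m -> J}) :
    (injectiveb f && (im f == S)) = (f \in h @: [set: 'S_m]).
  apply/andP/imsetP => [[/injectiveP f_inj /eqP imf]|[s _ ->]]; last first.
    split; first by apply/injectiveP=> i j; rewrite !ffunE => /f0_inj /perm_inj.
    rewrite -imf0; apply/eqP/setP=> x; apply/imsetP/imsetP => [[i _ ->]|[i _ ->]].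
      by exists (s i); rewrite ?ffunE.
    by exists (s^-1%g i); rewrite ?ffunE ?permKV.
  have /fin_all_exists[s sE] i : exists k, f i = f0 k.
    have : f i \in im f0 by rewrite imf0 -imf imset_f ?inE.
    by case/imsetP=> k _ ->; exists k.
  have s_inj : injective s by move=> i j ij; apply: f_inj; rewrite !sE ij.
  by exists (perm s_inj) => //; apply/ffunP=> i; rewrite ffunE permE sE.
rewrite (eq_bigl _ _ imh) big_imset /=; last by move=> s t _ _; apply: h_inj.
rewrite -imf0 DE // (eq_bigl xpredT); last by move=> s; rewrite inE.
have -> : \prod_(s in im f0) w s = \prod_i w (f0 i).
  rewrite big_imset /=; last by move=> i j _ _; apply: f0_inj.
  by apply: eq_bigl => i; rewrite inE.
(* Only one factor of the square is expanded by Leibniz; the sign of its term [s] comes from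
   permuting the rows of the other determinant by [s]. *)
rewrite [in RHS]expr2 -[RHS]mulrA [X in X * _]/determinant big_distrl /=.
apply: eq_bigr => s _.
have -> : \matrix_(i, j) B j (h s i) = row_perm s (\matrix_(i, j) B i (f0 j))^T.
  by apply/matrixP=> i j; rewrite !mxE ffunE.
rewrite row_permE det_mulmx det_perm det_tr.
have -> : \prod_i B i (h s i) = \prod_i (\matrix_(i, j) B i (f0 j)) i (s i).
  by apply: eq_bigr => i _; rewrite mxE ffunE.
have -> : \prod_i w (h s i) = \prod_i w (f0 i).
  by rewrite [RHS](reindex_perm s); apply: eq_bigr => i _; rewrite ffunE.
by rewrite mulrACA [X in X * _]mulrC [X in _ * X]mulrC.
Qed.

(** * The index of a full-rank sublattice *)

(** Finiteness is established first, since [fset_set] returns the empty set on an infinite one. *)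
Lemma card_fset_setT (T : finType) (U : choiceType) (g : T -> U) :
  injective g -> (forall u, exists t, g t = u) ->
  #|` cardinality.fset_set (@classical_sets.setT U)|%fset = #|T|.
Proof.
move=> g_inj g_onto.
have U_fin : cardinality.finite_set (@classical_sets.setT U).
  rewrite (_ : classical_sets.setT = classical_sets.image classical_sets.setT g).
    exact/cardinality.finite_image/cardinality.finite_finset.
  by apply/classical_sets.seteqP; split=> u //= _; have [t <-] := g_onto u; exists t.
rewrite (_ : cardinality.fset_set _ = [fset g t | t in T]%fset).
  by rewrite card_imfset /= -?cardE.
apply/fsetP=> u; rewrite cardinality.in_fset_set // classical_sets.in_setT.
by have [t <-] := g_onto u; apply/esym/imfsetP; exists t.
Qed.

(** The map [g] enumerates a transversal of the sublattice [N Z^m]. In Smith form [N = L D R] with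
    [L] and [R] unimodular, this sublattice is the image under [L] of [D Z^m], so vectors of
    residues modulo the diagonal entries, multiplied by [L], represent the cosets. *)
Lemma cosets_mulmx m (N : 'M[int]_m) : \det N != 0 ->
  exists (T : finType) (g : T -> 'cV[int]_m),
    [/\ #|T| = `|\det N|%N,
        forall t t', (exists z, g t - g t' = N *m z) -> t = t'
      & forall x, exists t z, x - g t = N *m z].
Proof.
move=> N_neq0; have [L Lu [R Ru [d _ NE]]] := int_Smith_normal_form N.
pose D : 'M[int]_m := \matrix_(i, j) (d`_i *+ (i == j :> nat)).
have DE : D = diag_mx (\row_i d`_i).
  by apply/matrixP=> i j; rewrite !mxE -val_eqE.
have abs1 (M : 'M[int]_m) : M \in unitmx -> `|\det M|%N = 1%N.
  rewrite unitmxE => /unitrP[a [_ /(congr1 absz)]].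
  by rewrite abszM => /eqP; rewrite muln_eq1 => /andP[/eqP].
have detN : `|\det N|%N = (\prod_(i < m) `|(d`_i)%R|)%N.
  rewrite NE !det_mulmx !abszM (abs1 _ Lu) (abs1 _ Ru) mul1n muln1 -/D DE det_diag.
  rewrite (big_morph absz abszM (erefl _)) /=.
  by apply: eq_bigr => i _; rewrite mxE.
(* This also rules out indices past the end of the list [d], where the default value is 0. *)
have d_neq0 (i : 'I_m) : d`_i != 0.
  apply: contraNneq N_neq0 => di0.
  by rewrite -absz_eq0 detN (bigD1 i) //= di0 mul0n.
have modE i (k : 'I_`|(d`_i)%R|%N) : ((k : nat)%:Z %% d`_i)%Z = k.
  by rewrite -modz_abs modz_small // ltz_nat ltn_ord.
pose T := {dffun forall i : 'I_m, 'I_`|(d`_i)%R|%N}.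
pose g (t : T) : 'cV[int]_m := L *m \col_i (t i : nat)%:Z.
exists T, g; split=> [|t t' [z]|x].
- rewrite detN card_dep_ffun foldrE big_image /=.
  by apply: eq_bigr => i _; rewrite card_ord.
- rewrite NE -/D -!mulmxA -mulmxBr => /(can_inj (mulKmx Lu)) /colP tt'.
  apply/ffunP=> i; apply/val_inj; move: (tt' i).
  rewrite DE mul_diag_mx !mxE => /(canRL (subrK _)) ti.
  have := congr1 (modz^~ d`_i) ti.
  by rewrite [d`_i * _]mulrC modzMDl !modE => -[].
- rewrite -(mulKVmx Lu x); move: (invmx L *m x) => {x} y.
  have /fin_all_exists[r rE] (i : 'I_m) :
      exists k : 'I_`|(d`_i)%R|%N, (k : nat)%:Z = (y i ord0 %% d`_i)%Z.
    have lt_r : (`|(y i ord0 %% d`_i)%Z| < `|(d`_i)%R|)%N.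
      by rewrite -ltz_nat gez0_abs ?modz_ge0 // abszE ltz_mod.
    by exists (Ordinal lt_r) => /=; rewrite /= gez0_abs ?modz_ge0.
  (* Coordinatewise Euclidean division of [y]: remainders select the representative, quotients
     pulled back through [R] give the lattice vector. *)
  exists (finfun r), (invmx R *m \col_i (y i ord0 %/ d`_i)%Z).
  rewrite NE -/D mulmxA mulmxK // -mulmxA -mulmxBr.
  congr (L *m _); apply/colP=> i; rewrite DE mul_diag_mx !mxE ffunE rE.
  apply: (canLR (addrK _)); rewrite mulrC; exact: divz_eq.
Qed.

(** * Linear independence of families indexed by a set *)

(** Replaces coefficients indexed by positions in a sequence with coefficients indexed by faces, the
    form needed for the columns and rows of a forest. *)
Lemma free_imageP (K : fieldType) (V : vectType K) (T : finType) (S : {set T})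
    (g : T -> V) :
  reflect (forall c : T -> K,
             \sum_(x in S) c x *: g x = 0 -> {in S, forall x, c x = 0})
          (free [seq g x | x in S]).
Proof.
pose X := [tuple g (enum_val i) | i < #|S|].
have XE : [seq g x | x in S] = X.
  apply: (@eq_from_nth _ 0); rewrite !size_tuple // => i lt_i.
  by rewrite (nth_image 0 g (Ordinal lt_i)) -(tnth_nth 0 X (Ordinal lt_i)) tnth_mktuple.
have sumX (k : 'I_#|S| -> K) :
    \sum_(i < #|S|) k i *: X`_i = \sum_i k i *: g (enum_val i).
  by apply: eq_bigr => i _; rewrite -tnth_nth tnth_mktuple.
have X_freeP := @freeP _ _ _ X.
rewrite XE; apply: (iffP X_freeP) => [X_free c|X_free k].
  rewrite big_enum_val -sumX => /X_free c0 x xS.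
  by rewrite -(enum_rankK_in xS xS) c0.
pose c x := \sum_(i | enum_val i == x) k i.
have cE i : c (enum_val i) = k i.
  by rewrite /c (big_pred1 i) // => j; rewrite (inj_eq enum_val_inj).
move=> k0 i; rewrite -cE; apply: X_free (enum_valP i).
by rewrite big_enum_val -[RHS]k0 sumX; apply: eq_bigr => j _; rewrite cE.
Qed.

Lemma dim_row_fullv (K : fieldType) k : \dim {: 'rV[K]_k} = k.
Proof. by rewrite dimvf dim_matrix; apply: mul1n. Qed.

(** * The matrix [M | Id], its column sets and its maximal minors *)

Section AugmentedBoundary.
Variables (n d : nat) (G : {set {set 'I_n}}).
Local Notation facets := (face G d).
Local Notation ridges := (face G (d%:Z - 1)).
Local Notation m := #|ridges|.
Implicit Types (F : {set facets}) (R : {set ridges}).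

Definition augmented_boundary (A : pzRingType) (i : 'I_m) (s : facets + ridges) : A :=
  match s with
  | inl f => boundary A G d i (enum_rank f)
  | inr r => (i == enum_rank r)%:R
  end.

(** An injective [phi] both selects and orders the columns, so the determinant is fixed by the
    column set up to sign. *)
Definition augmented_minor (A : pzRingType) (phi : 'I_m -> facets + ridges) : 'M[A]_m :=
  \matrix_(i, j) augmented_boundary A i (phi j).

Definition face_union F R : {set facets + ridges} :=
  [set s | match s with inl f => f \in F | inr r => r \in R end].

Lemma card_face_union F R : #|face_union F R| = (#|F| + #|R|)%N.
Proof.
rewrite -!sum1_card
  (eq_bigl (fun s => match s with inl f => f \in F | inr r => r \in R end)).
  by rewrite big_sumType.
by move=> s; rewrite inE.
Qed.

Lemma prod_face_union (A : comPzRingType) (w : facets + ridges -> A) F R :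
  \prod_(s in face_union F R) w s
  = (\prod_(r in R) w (inr r)) * (\prod_(f in F) w (inl f)).
Proof.
rewrite
  (eq_bigl (fun s => match s with inl f => f \in F | inr r => r \in R end)).
  by rewrite big_sumType mulrC.
by move=> s; rewrite inE.
Qed.

Lemma face_union_bij :
  bijective (fun p : {set facets} * {set ridges} => face_union p.1 p.2).
Proof.
exists (fun S : {set facets + ridges} =>
  ([set f | inl f \in S], [set r | inr r \in S])) => [[F R]|S] /=.
  by congr (_, _); apply/setP=> s; rewrite !inE.
by apply/setP=> -[f|r]; rewrite !inE.
Qed.

Lemma boundary_intr (A : pzRingType) : boundary A G d = map_mx intr (boundary int G d).
Proof.
apply/matrixP=> i j; rewrite !mxE /incidence; case: pickP => [v _|_] //.
by rewrite rmorph_sign.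
Qed.

(** One integer minor serves every ring: independence is tested over [K], homology over the
    integers, and the expansion holds over any commutative [A]. *)
Lemma augmented_minor_intr (A : pzRingType) phi :
  augmented_minor A phi = map_mx intr (augmented_minor int phi).
Proof.
apply/matrixP=> i j; rewrite !mxE; case: (phi j) => [f|r] /=.
  by rewrite boundary_intr mxE.
by rewrite rmorph_nat.
Qed.

(** As [h] vanishes off the selected columns, the product may be summed over all columns and then
    split into a boundary and a chain of ridges. *)
Lemma mul_augmented_minor (A : pzRingType) phi (h : facets + ridges -> A) :
    injective phi -> (forall s, s \notin phi @: setT -> h s = 0) ->
  augmented_minor A phi *m \col_j h (phi j)
  = boundary A G d *m (\col_j h (inl (enum_val j))) + \col_i h (inr (enum_val i)).
Proof.
move=> phi_inj h0; apply/colP=> i; rewrite !mxE.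
transitivity (\sum_s augmented_boundary A i s * h s).
  rewrite [RHS](bigID (mem (phi @: [set: 'I_m]))) /= [X in _ = _ + X]big1 ?addr0.
    rewrite big_imset /=; last by move=> j k _ _; apply: phi_inj.
    by apply: eq_big => [j|j _]; rewrite ?inE ?mxE.
  by move=> s /h0->; rewrite mulr0.
rewrite big_sumType /=; congr (_ + _).
  rewrite [RHS](reindex enum_rank) /=; last exact/onW_bij/enum_rank_bij.
  by apply: eq_bigr => f _; rewrite !mxE enum_rankK.
rewrite (bigD1 (enum_val i)) //= enum_valK eqxx mul1r big1 ?addr0 // => r ri.
by rewrite -(inj_eq enum_val_inj) enum_rankK eq_sym (negPf ri) mul0r.
Qed.

Lemma mulmx_augmented_minor (A : pzRingType) phi (u : 'rV[A]_m) j :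
  (u *m augmented_minor A phi) 0 j
  = match phi j with
    | inl f => (u *m boundary A G d) 0 (enum_rank f)
    | inr r => u 0 (enum_rank r)
    end.
Proof.
rewrite mxE; case E: (phi j) => [f|r].
  by rewrite mxE; apply: eq_bigr => i _; rewrite mxE E.
rewrite (bigD1 (enum_rank r)) //= big1 ?addr0 => [|i ir]; rewrite mxE E /=.
  by rewrite eqxx mulr1.
by rewrite (negPf ir) mulr0.
Qed.

Lemma sum_cols_boundary (A : comPzRingType) F (c : facets -> A) :
  \sum_(f in F) c f *: col (enum_rank f) (boundary A G d)
  = boundary A G d *m \col_j (if enum_val j \in F then c (enum_val j) else 0).
Proof.
apply/colP=> i; rewrite summxE mxE big_mkcond /=.
rewrite [RHS](reindex enum_rank) /=; last exact/onW_bij/enum_rank_bij.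
apply: eq_bigr => f _; rewrite !mxE enum_rankK.
by case: ifP => _; rewrite ?mulr0 // mulrC.
Qed.

Lemma sum_forest_rows (K : realType) F R (c : ridges -> K) (j : 'I_#|F|) :
  (\sum_(r in ~: R) c r *: forest_row K F r) 0 j
  = ((\row_i (if enum_val i \in R then 0 else c (enum_val i))) *m boundary K G d)
      0 (enum_rank (enum_val j)).
Proof.
rewrite summxE mxE big_mkcond /=.
rewrite [RHS](reindex enum_rank) /=; last exact/onW_bij/enum_rank_bij.
apply: eq_bigr => r _; rewrite !mxE enum_rankK inE.
by case: (r \in R); rewrite ?mul0r.
Qed.

(** Row rank equals column rank: independent columns force the rows to span the whole space, so a
    root is a complement whose rows form a basis of the space of dimension [#|F|]. *)
Lemma span_forest_rows (K : realType) F : forest K F ->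
  <<[seq forest_row K F r | r : ridges]>>%VS = fullv.
Proof.
move=> /free_imageP F_free.
have : row_full (forest_boundary K F).
  rewrite /row_full -mxrank_tr; apply: inj_row_free => v vA0.
  pose c f := \sum_(j | enum_val j == f) v 0 j.
  have cE j : c (enum_val j) = v 0 j.
    by rewrite /c (big_pred1 j) // => k; rewrite (inj_eq enum_val_inj).
  apply/rowP=> j; rewrite mxE -cE; apply: F_free (enum_valP j).
  rewrite big_enum_val; apply/colP=> i; rewrite summxE.
  move/rowP/(_ i): vA0; rewrite !mxE => vA0; rewrite -[RHS]vA0.
  by apply: eq_bigr => k _; rewrite !mxE cE.
move=> /row_fullP[B BE].
apply/eqP; rewrite eqEsubv subvf /=; apply/subvP=> u _.
rewrite -[u]mulmx1 -BE mulmxA mulmx_sum_row; apply: memv_suml => i _.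
apply/memvZ/memv_span/imageP; exists (enum_val i) => //.
by rewrite /forest_row enum_valK.
Qed.

Lemma card_rooted_forest (K : realType) F R :
  rooted_forest K F R -> (#|F| + #|R|)%N = m.
Proof.
move=> /andP[F_forest]; rewrite /root_of span_forest_rows // => FR_basis.
have := vector.size_basis (X := [tuple of [seq forest_row K F r | r in ~: R]]) FR_basis.
by rewrite dim_row_fullv => ->; rewrite addnC cardsC.
Qed.

(** * Nonzero minors are rooted forests *)

Lemma rooted_forestE (K : realType) F R (phi : 'I_m -> facets + ridges) :
    injective phi -> phi @: setT = face_union F R ->
  rooted_forest K F R = (\det (augmented_minor int phi) != 0).
Proof.
move=> phi_inj phiE.
have card_FR : (#|F| + #|R|)%N = m.
  by rewrite -card_face_union -phiE card_imset // cardsT card_ord.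
have phiF f : f \in F -> exists k, phi k = inl f.
  move=> fF; have : inl f \in face_union F R by rewrite inE.
  by rewrite -phiE => /imsetP[k _ ->]; exists k.
have phiR r : r \in R -> exists k, phi k = inr r.
  move=> rR; have : inr r \in face_union F R by rewrite inE.
  by rewrite -phiE => /imsetP[k _ ->]; exists k.
have phi_in k : phi k \in face_union F R by rewrite -phiE imset_f ?inE.
have -> : (\det (augmented_minor int phi) != 0) = (augmented_minor K phi \in unitmx).
  by rewrite unitmxE [in RHS]augmented_minor_intr det_map_mx unitfE intr_eq0.
apply/idP/idP => [/andP[F_forest]|N_unit].
  (* A left kernel vector [v] vanishes on [R] because of the unit columns; the columns of [F] then
     make it a relation among the rows outside [R], hence zero. *)
  rewrite /root_of => /basis_free/free_imageP R_free.
  rewrite -row_free_unit; apply: inj_row_free => v vN0.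
  pose c r := v 0 (enum_rank r).
  have cR r : r \in R -> c r = 0.
    move=> /phiR[k phik]; have := mulmx_augmented_minor phi v k.
    by rewrite vN0 phik mxE /c => <-.
  have vE : v = \row_i (if enum_val i \in R then 0 else c (enum_val i)).
    apply/rowP=> i; rewrite mxE; case: ifP => [/cR|_]; last by rewrite /c enum_valK.
    by rewrite /c enum_valK.
  have c0 : {in ~: R, forall r, c r = 0}.
    apply: R_free; apply/rowP=> j; rewrite sum_forest_rows -vE [RHS]mxE.
    have [k phik] := phiF _ (enum_valP j).
    by have := mulmx_augmented_minor phi v k; rewrite vN0 phik mxE => <-.
  apply/rowP=> i; rewrite vE !mxE; case: ifP => // iR.
  by rewrite c0 // inE iR.
apply/andP; split.
  apply/free_imageP=> c; rewrite sum_cols_boundary => Mc0 f fF.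
  (* A relation among the columns of [F], extended by 0 to the unit columns, lies in the right
     kernel of the minor. *)
  pose h (s : facets + ridges) := match s with
    | inl f => if f \in F then c f else 0 | inr _ => 0 end.
  have h0 s : s \notin phi @: setT -> h s = 0.
    by rewrite phiE inE; case: s => //= g /negPf->.
  have := mul_augmented_minor phi_inj h0.
  rewrite (_ : \col_j h (inl _)
      = \col_j (if enum_val j \in F then c (enum_val j) else 0)).
  2: by apply/colP=> j; rewrite !mxE.
  rewrite Mc0 (_ : \col_i h (inr _) = 0) ?addr0; last by apply/colP=> j; rewrite !mxE.
  move=> /(congr1 (mulmx (invmx (augmented_minor K phi)))).
  rewrite mulKmx // mulmx0 => /colP hphi.
  have [k phik] := phiF _ fF.
  by have := hphi k; rewrite !mxE phik /= fF.
rewrite /root_of basisEfree; apply/and3P; split.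
- apply/free_imageP=> c /rowP Mc0 r; rewrite inE => rR.
  (* Dually, a relation among the rows outside [R], extended by 0 on [R], lies in the left
     kernel. *)
  pose u : 'rV[K]_m := \row_i (if enum_val i \in R then 0 else c (enum_val i)).
  have : u *m augmented_minor K phi = 0.
    apply/rowP=> j; rewrite mulmx_augmented_minor [RHS]mxE.
    have := phi_in j; rewrite inE; case: (phi j) => [f fF|s sR].
      have := Mc0 (enum_rank_in fF f).
      by rewrite sum_forest_rows enum_rankK_in // => ->; rewrite mxE.
    by rewrite mxE enum_rankK sR.
  move=> /(congr1 (mulmxr (invmx (augmented_minor K phi)))) /=.
  rewrite mulmxK // mul0mx => /rowP/(_ (enum_rank r)).
  by rewrite !mxE enum_rankK (negPf rR).
- apply/span_subvP=> v /imageP[r _ ->]; apply: memv_span.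
  by apply/imageP; exists r.
(* Spanning follows by counting: there are [#|F|] rows outside [R], because [#|F| + #|R|] is [m]. *)
- rewrite size_image (leq_trans (dimvS (subvf _))) // dim_row_fullv.
  by rewrite -(leq_add2r #|R|) card_FR addnC cardsC.
Qed.

(** * Relative homology as the cokernel of a minor *)

(** The entries of [z] at columns in [F] are the coefficients of [c], and those at columns in [R]
    are the coefficients of the remainder [v - boundary c]. *)
Lemma coset_augmented_minor F R phi (v : chain G (d%:Z - 1)) :
    injective phi -> phi @: setT = face_union F R ->
  (exists2 c, c \in chain_on F & v - boundary int G d *m c \in chain_on R)
  <-> exists z, v = augmented_minor int phi *m z.
Proof.
move=> phi_inj phiE; split=> [[c cF vR]|[z ->]].
  pose h (s : facets + ridges) := match s with
    | inl f => c (enum_rank f) 0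
    | inr r => (v - boundary int G d *m c) (enum_rank r) 0 end.
  have h0 s : s \notin phi @: setT -> h s = 0.
    rewrite phiE inE; case: s => [f|r] /= sFR.
      exact/eqP/(implyP (forallP cF f)).
    exact/eqP/(implyP (forallP vR r)).
  exists (\col_j h (phi j)); rewrite mul_augmented_minor //.
  rewrite (_ : \col_j h (inl _) = c); last by apply/colP=> j; rewrite mxE /= enum_valK.
  rewrite (_ : \col_i h (inr _) = v - boundary int G d *m c).
    exact/esym/subrKC.
  by apply/colP=> i; rewrite mxE /h enum_valK.
pose h s := \sum_(j | phi j == s) z j 0.
have hE j : h (phi j) = z j 0.
  by rewrite /h (big_pred1 j) // => k; rewrite (inj_eq phi_inj).
have h0 s : s \notin phi @: setT -> h s = 0.
  move=> s_phi; rewrite /h big_pred0 // => k.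
  by apply: contraNF s_phi => /eqP<-; rewrite imset_f ?inE.
have zE : z = \col_j h (phi j) by apply/colP=> j; rewrite mxE hE.
exists (\col_j h (inl (enum_val j))).
  apply/forallP=> f; apply/implyP=> fF; rewrite mxE enum_rankK h0 //.
  by rewrite phiE inE.
rewrite {1}zE mul_augmented_minor // (addrC (boundary _ _ _ *m _)) addrK.
apply/forallP=> r; apply/implyP=> rR; rewrite mxE enum_rankK h0 //.
by rewrite phiE inE.
Qed.

(** The group is an iterated quotient, first by the chains on [R], then by the image of [Psi]. The
    composite projection [cls] has the column lattice of the minor as kernel, so a transversal of
    that lattice maps bijectively onto the group. *)
Lemma homology_cardE F R phi :
    injective phi -> phi @: setT = face_union F R ->
    \det (augmented_minor int phi) != 0 ->
  homology_card F R = `|\det (augmented_minor int phi)|%N.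
Proof.
move=> phi_inj phiE /cosets_mulmx[T [g [<- g_inj g_onto]]].
pose cls (v : chain G (d%:Z - 1)) : relative_homology F R :=
  \pi_({quot Psi_image F R}) (\pi_({quot chain_on R}) v).
have clsE v w : cls v = cls w <-> exists z, v - w = augmented_minor int phi *m z.
  rewrite -(coset_augmented_minor _ phi_inj phiE).
  have PsiE c : (Psi R c == \pi_({quot chain_on R}) (v - w))
      = (v - w - boundary int G d *m c \in chain_on R).
    by rewrite Quotient.idealrBE eq_sym.
  have := Quotient.idealrBE (Psi_image F R)
    (\pi_({quot chain_on R}) v) (\pi_({quot chain_on R}) w).
  rewrite -raddfB => clsE; split.
    move=> /eqP; rewrite -clsE => /asboolP[c cF /eqP]; rewrite PsiE.
    by exists c.
  move=> [c cF]; rewrite -PsiE => /eqP PsiE'; apply/eqP; rewrite -clsE.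
  by apply/asboolP; exists c.
apply: (@card_fset_setT _ _ (cls \o g)) => [t t' /clsE /g_inj //|u].
elim/quotW: u => u; elim/quotW: u => x.
have [t [z xz]] := g_onto x.
by exists t; apply/esym/clsE; exists z.
Qed.

End AugmentedBoundary.

(** * The forest expansion and its specializations *)

Lemma weighted_forest_expansion (A : comPzRingType) (K : realType) n d
    (G : {set {set 'I_n}})
    (x : face G (d%:Z - 1) -> A) (y : face G d -> A) :
  \sum_(p : {set face G d} * {set face G (d%:Z - 1)} | rooted_forest K p.1 p.2)
      (homology_card p.1 p.2)%:R ^+ 2
        * (\prod_(r in p.2) x r) * (\prod_(f in p.1) y f)
    = \det (weighted_laplacian y + diag_mx (\row_i x (enum_val i))).
Proof.
pose w s := match s with inl f => y f | inr r => x r end.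
have [g gK g'K] := face_union_bij d G.
(* The value 0 off rooted forests agrees with the vanishing of the corresponding squared minors. *)
pose D S : A := if rooted_forest K (g S).1 (g S).2
  then (homology_card (g S).1 (g S).2)%:R ^+ 2 else 0.
have DE F R : D (face_union F R)
    = if rooted_forest K F R then (homology_card F R)%:R ^+ 2 else 0.
  by rewrite /D (gK (F, R)).
have -> : weighted_laplacian y + diag_mx (\row_i x (enum_val i))
    = \matrix_(i, j) \sum_s augmented_boundary A i s * w s * augmented_boundary A j s.
  apply/matrixP=> i j; rewrite [RHS]mxE big_sumType mxE; congr (_ + _).
    rewrite mxE [LHS](reindex enum_rank) /=; last exact/onW_bij/enum_rank_bij.
    by apply: eq_bigr => f _; rewrite mul_mx_diag !mxE enum_rankK.
  rewrite (bigD1 (enum_val i)) //= big1 => [|r ri].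
    by rewrite enum_valK eqxx mul1r addr0 !mxE eq_sym mulr_natr.
  by rewrite -(inj_eq enum_val_inj) enum_rankK eq_sym (negPf ri) !mul0r.
rewrite (cauchy_binet_gram w (D := D)) => [|phi phi_inj].
  rewrite (reindex _ (onW_bij _ (face_union_bij d G))) /=.
  rewrite big_mkcond [RHS]big_mkcond; apply: eq_bigr => -[F R] _ /=.
  rewrite DE prod_face_union card_face_union; case: ifP => [FR|_].
    (* A rooted forest automatically meets the size condition [#|S| == m] of Cauchy-Binet. *)
    by rewrite (card_rooted_forest FR) eqxx mulrA.
  by rewrite mul0r if_same.
have /esym := g'K (phi @: setT); case: (g _) => F R /= phiE.
rewrite phiE DE (rooted_forestE K phi_inj phiE).
rewrite -/(augmented_minor A phi) [in RHS]augmented_minor_intr det_map_mx.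
have [-> /=|N_neq0 /=] := eqVneq (\det (augmented_minor int phi)) 0.
  by rewrite rmorph0 expr0n.
rewrite (homology_cardE phi_inj phiE) // -[in RHS]rmorphXn /=.
(* Squaring absorbs the sign: the homology count is only the absolute value of the minor. *)
by rewrite -[in RHS]real_normK ?num_real // -abszE rmorphXn.
Qed.

Theorem theorem19 (K : realType) (n d : nat) (G : {set {set 'I_n}})
    (G_complex : simplicial_complex G) (dim_G : complex_dim G = d%:Z) :
  \sum_(p : {set face G d} * {set face G (d%:Z - 1)} | rooted_forest K p.1 p.2)
      (homology_card p.1 p.2)%:R ^+ 2 * 'X^#|p.2|
    = \det (laplacian {poly int} G d + 'X%:M)
  /\
  \sum_(p : {set face G d} * {set face G (d%:Z - 1)} | rooted_forest K p.1 p.2)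
      (homology_card p.1 p.2)%:R ^+ 2
        * (\prod_(r in p.2) xvar r) * (\prod_(f in p.1) yvar f)
    = \det (weighted_laplacian (@yvar n G d)
            + diag_mx (\row_i @xvar n G d (enum_val i))).
Proof.
split; last exact: weighted_forest_expansion.
(* The one-variable identity is the case where every [x_r] is ['X] and every [y_f] is 1. *)
apply: etrans (etrans _ (@weighted_forest_expansion {poly int} K n d G
  (fun _ => 'X) (fun _ => 1))) _.
  by apply: eq_bigr => p _; rewrite prodr_const big1_eq mulr1.
congr (\det (_ + _)); last first.
  by rewrite -diag_const_mx; congr diag_mx; apply/rowP=> i; rewrite !mxE.
rewrite /weighted_laplacian /laplacian (_ : diag_mx _ = 1%:M) ?mulmx1 //.
by rewrite -diag_const_mx; congr diag_mx; apply/rowP=> i; rewrite !mxE.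
Qed.
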